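(* Let $R$ be a ring, $G$ a finite group acting on $R$, $H$ a subgroup of $G$, and $n,d\ge 0$ integers. If the skew group ring $RG$ is a left $(n,d)$-ring, then so is $RH$. Moreover, if $RG$ is a separable extension over $RH$, then $RG$ is a left $(n,d)$-ring if and only if $RH$ is a left $(n,d)$-ring.
   Context: Rings are associative with identity; modules are unitary and are left modules unless otherwise specified. $G$ acts on $R$ by ring automorphisms: $r\mapsto g(r)$ is a ring automorphism for each $g\in G$, $(g_1g_2)(r)=g_1(g_2(r))$ and $1(r)=r$. The skew group ring $RG$ is the free left $R$-module with basis $G$ and multiplication $(ag)(bh)=a\,g(b)\,gh$ for $a,b\in R$, $g,h\in G$. For a subgroup $H\le G$ (with the restricted action), $RH$ is a subring of $RG$. A ring $A$ is a separable extension over a subring $S$ if the multiplication map $A\otimes_S A\to A$, $a\otimes b\mapsto ab$, splits as a map of $A$-$A$-bimodules; i.e. there is $\sum_i a_i\otimes b_i\in A\otimes_S A$ with $\sum_i a_i\otimes b_i a=\sum_i a a_i\otimes b_i$ for all $a\in A$ and $\sum_i a_ib_i=1$. An $A$-module $M$ is finitely $n$-presented if there is an exact sequence $F_n\to F_{n-1}\to\cdots\to F_0\to M\to 0$ with all $F_i$ ($0\le i\le n$) finitely generated projective. A ring $A$ is a left $(n,d)$-ring if every finitely $n$-presented left $A$-module has projective dimension at most $d$. *)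

(* Defs.v *)
From HB Require Import structures.
From mathcomp Require Import all_boot all_order all_algebra all_fingroup.

Set Implicit Arguments.
Unset Strict Implicit.
Unset Printing Implicit Defensive.

Import GRing.Theory.
Local Open Scope ring_scope.

(* Rings are [pzRingType]s: associative, unital, possibly the zero ring.
   [lmodType A] is the type of unitary left A-modules. *)

(* By the two laws [ra_act g] is bijective with inverse [ra_act g^-1], so it is
   a ring automorphism. *)
Record ring_action (G : finGroupType) (R : pzRingType) := RingAction {
  ra_act :> G -> {rmorphism R -> R};
  ra_act1 : forall r, ra_act 1%g r = r;
  ra_actM : forall g h r, ra_act (g * h)%g r = ra_act g (ra_act h r)
}.

(* The function x stands for \sum_g (x g) g. *)
Definition skew_ring (G : finGroupType) (R : pzRingType)
  (alpha : ring_action G R) : Type := {ffun G -> R}.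

Section SkewGroupRing.
Variables (G : finGroupType) (R : pzRingType) (alpha : ring_action G R).
Local Notation skew_ring := (skew_ring alpha).

HB.instance Definition _ := GRing.Zmodule.copy skew_ring {ffun G -> R}.


Definition skew_mono (a : R) (g : G) : skew_ring :=
  [ffun k => if k == g then a else 0].

Definition skew_one : skew_ring := skew_mono 1 1%g.

Definition skew_mul (x y : skew_ring) : skew_ring :=
  [ffun k => \sum_(g : G) x g * alpha g (y (g^-1 * k)%g)].

Fact skew_mulA : associative skew_mul.
Proof.
move=> x y z; apply/ffunP => k; rewrite !ffunE.
under eq_bigr => h _ do rewrite ffunE rmorph_sum mulr_sumr.
under [RHS]eq_bigr => g _ do rewrite ffunE mulr_suml.
rewrite [RHS]exchange_big; apply: eq_bigr => h _ /=.
rewrite [RHS](reindex_inj (mulgI h)) /=; apply: eq_bigr => m _.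
by rewrite mulKg ra_actM invMg mulgA rmorphM mulrA.
Qed.

Fact skew_mul1 : left_id skew_one skew_mul.
Proof.
move=> x; apply/ffunP => k; rewrite ffunE (bigD1 1%g) //= big1 => [|g /negPf ng].
  by rewrite ffunE eqxx invg1 mul1g ra_act1 mul1r addr0.
by rewrite ffunE ng mul0r.
Qed.

Fact skew_mulr1 : right_id skew_one skew_mul.
Proof.
move=> x; apply/ffunP => k; rewrite ffunE (bigD1 k) //= big1 => [|g ng].
  by rewrite ffunE mulVg eqxx rmorph1 mulr1 addr0.
rewrite ffunE ifN ?rmorph0 ?mulr0 //.
by apply: contra ng => /eqP e; rewrite -(mulg1 g) -e mulKVg.
Qed.

Fact skew_mulDl : left_distributive skew_mul +%R.
Proof.
move=> x y z; apply/ffunP => k; rewrite !ffunE -big_split.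
by apply: eq_bigr => g _; rewrite ffunE mulrDl.
Qed.

Fact skew_mulDr : right_distributive skew_mul +%R.
Proof.
move=> x y z; apply/ffunP => k; rewrite !ffunE -big_split.
by apply: eq_bigr => g _; rewrite ffunE rmorphD mulrDr.
Qed.

HB.instance Definition _ := GRing.Zmodule_isPzRing.Build skew_ring
  skew_mulA skew_mul1 skew_mulr1 skew_mulDl skew_mulDr.

Lemma skew_monoM (a b : R) (g h : G) :
  skew_mono a g * skew_mono b h = skew_mono (a * alpha g b) (g * h)%g.
Proof.
apply/ffunP => k; rewrite !ffunE (bigD1 g) //= big1 => [|m /negPf nm].
  rewrite !ffunE eqxx addr0 -(inj_eq (mulgI g)) mulKVg.
  by case: ifP; rewrite ?rmorph0 ?mulr0.
by rewrite ffunE nm mul0r.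
Qed.

Lemma skew_sum_mono (x : skew_ring) : x = \sum_(g : G) skew_mono (x g) g.
Proof.
apply/ffunP => k; rewrite sum_ffunE (bigD1 k) //= big1 => [|g ng].
  by rewrite ffunE eqxx addr0.
by rewrite ffunE eq_sym (negPf ng).
Qed.

End SkewGroupRing.

Definition restrict_action (G : finGroupType) (R : pzRingType)
    (alpha : ring_action G R) (H : {group G}) : ring_action (subg_of H) R :=
  @RingAction (subg_of H) R (fun h => alpha (sgval h))
    (ra_act1 alpha) (fun g h => ra_actM alpha (sgval g) (sgval h)).

Section SkewSubring.
Variables (G : finGroupType) (R : pzRingType) (alpha : ring_action G R).
Variable H : {group G}.

(* The inclusion of RH in RG. *)
Definition skew_incl (x : skew_ring (restrict_action alpha H)) :
    skew_ring alpha :=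
  [ffun g => if g \in H then x (subg H g) else 0].

Fact skew_incl_zmod_morphism : zmod_morphism skew_incl.
Proof.
move=> x y; apply/ffunP => g; rewrite !ffunE.
by case: ifP; rewrite ?subr0.
Qed.

HB.instance Definition _ :=
  GRing.isZmodMorphism.Build _ _ skew_incl skew_incl_zmod_morphism.

Lemma skew_incl_mono (a : R) (h : subg_of H) :
  skew_incl (skew_mono _ a h) = skew_mono alpha a (sgval h).
Proof.
apply/ffunP => g; rewrite !ffunE; have [gH|gnH] := boolP (g \in H).
  by congr (if _ then _ else _); rewrite -(inj_eq val_inj) /= subgK.
by rewrite ifN //; apply: contraNneq gnH => ->; apply: subgP.
Qed.

Fact skew_incl_monoid_morphism : monoid_morphism skew_incl.
Proof.
split=> [|x y]; first exact: skew_incl_mono.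
rewrite (skew_sum_mono x) (skew_sum_mono y) big_distrlr /= !raddf_sum.
rewrite big_distrlr /=; apply: eq_bigr => g _.
rewrite raddf_sum; apply: eq_bigr => h _.
by rewrite skew_monoM /= !skew_incl_mono skew_monoM.
Qed.

HB.instance Definition _ :=
  GRing.isMonoidMorphism.Build _ _ skew_incl skew_incl_monoid_morphism.

Lemma skew_incl_inj : injective skew_incl.
Proof.
move=> x y /ffunP e; apply/ffunP => h.
by have := e (sgval h); rewrite !ffunE subgP sgvalK.
Qed.

End SkewSubring.

Section Separable.
Variables (S A : pzRingType) (iota : {rmorphism S -> A}).

(* Equality in A (x)_S A, where the sequence [:: (a_1, b_1); ...; (a_k, b_k)]
   stands for \sum_i a_i (x) b_i.  Every element of A (x)_S A is of this form
   since - (a (x) b) = (- a) (x) b. *)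
Inductive tensor_eq : seq (A * A) -> seq (A * A) -> Prop :=
| tensor_refl s : tensor_eq s s
| tensor_sym s t : tensor_eq s t -> tensor_eq t s
| tensor_trans s t u : tensor_eq s t -> tensor_eq t u -> tensor_eq s u
| tensor_cat s s' t t' :
    tensor_eq s s' -> tensor_eq t t' -> tensor_eq (s ++ t) (s' ++ t')
| tensor_catC s t : tensor_eq (s ++ t) (t ++ s)
| tensor_0l b : tensor_eq [:: (0, b)] [::]
| tensor_Dl a a' b : tensor_eq [:: (a + a', b)] [:: (a, b); (a', b)]
| tensor_Dr a b b' : tensor_eq [:: (a, b + b')] [:: (a, b); (a, b')]
| tensor_balanced a r b :
    tensor_eq [:: (a * iota r, b)] [:: (a, iota r * b)].

(* A is a separable extension over (the image of) S. *)
Definition separable_extension : Prop :=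
  exists s : seq (A * A),
    (forall a, tensor_eq [seq (x.1, x.2 * a) | x <- s]
                         [seq (a * x.1, x.2) | x <- s]) /\
    \sum_(x <- s) x.1 * x.2 = 1.

(* Balanced biadditive maps factor through [tensor_eq]. *)
Lemma tensor_eq_sum (V : zmodType) (f : A -> A -> V) :
    (forall a a' b, f (a + a') b = f a b + f a' b) ->
    (forall a b b', f a (b + b') = f a b + f a b') ->
    (forall a r b, f (a * iota r) b = f a (iota r * b)) ->
  forall s t, tensor_eq s t ->
    \sum_(x <- s) f x.1 x.2 = \sum_(x <- t) f x.1 x.2.
Proof.
move=> fDl fDr fM s t; elim=> {s t}
  [//|s t _ //|s t u _ -> _ //|s s' t t' _ e _ e'|s t|b|a a' b|a b b'|a r b].
- by rewrite !big_cat /= e e'.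
- by rewrite !big_cat /= addrC.
- rewrite big_seq1 big_nil /=; apply: (@addrI _ (f 0 b)).
  by rewrite -fDl !addr0.
- by rewrite big_seq1 big_cons big_seq1 /= fDl.
- by rewrite big_seq1 big_cons big_seq1 /= fDr.
- by rewrite !big_seq1 /= fM.
Qed.

End Separable.

Section Modules.
Variable A : pzRingType.

Definition surjective_map (M N : lmodType A) (f : {linear M -> N}) : Prop :=
  forall y, exists x, f x = y.

(* Exactness of L -f-> M -g-> N at M. *)
Definition exact_at (L M N : lmodType A)
    (f : {linear L -> M}) (g : {linear M -> N}) : Prop :=
  forall y, g y = 0 <-> exists x, f x = y.

Definition fin_generated (M : lmodType A) : Prop :=
  exists (k : nat) (e : 'I_k -> M),
    forall x, exists c : 'I_k -> A, x = \sum_(i < k) c i *: e i.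

Definition projective (P : lmodType A) : Prop :=
  forall (M N : lmodType A) (p : {linear M -> N}) (f : {linear P -> N}),
    surjective_map p -> exists h : {linear P -> M}, forall x, p (h x) = f x.

(* Only F 0, ..., F n and the maps between them are constrained; the rest of
   the sequence is irrelevant. *)
Definition fin_presented (n : nat) (M : lmodType A) : Prop :=
  exists (F : nat -> lmodType A) (d : forall i, {linear F i.+1 -> F i})
         (e : {linear F 0%N -> M}),
    [/\ surjective_map e,
        (0 < n)%N -> exact_at (d 0%N) e,
        forall i, (i.+1 < n)%N -> exact_at (d i.+1) (d i)
      & forall i, (i <= n)%N -> fin_generated (F i) /\ projective (F i)].

(* M has a projective resolution of length at most m:
   0 -> P_m -> ... -> P_0 -> M -> 0. *)
Definition proj_dim_le (m : nat) (M : lmodType A) : Prop :=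
  exists (P : nat -> lmodType A) (d : forall i, {linear P i.+1 -> P i})
         (e : {linear P 0%N -> M}),
    [/\ surjective_map e /\ exact_at (d 0%N) e,
        forall i, exact_at (d i.+1) (d i),
        forall i, projective (P i)
      & forall i, (m < i)%N -> forall x : P i, x = 0].

End Modules.

Definition left_nd_ring (n d : nat) (A : pzRingType) : Prop :=
  forall M : lmodType A, fin_presented n M -> proj_dim_le d M.

(* Main.v *)
From HB Require Import structures.
Require Import Defs.
From mathcomp Require Import all_boot all_order all_algebra all_fingroup.

(** Write RG (x)_RH M as the coinduced module
    [{f : G -> M | f (h x) = h (f x) for h in H}]. It is both a left and a right
    adjoint of restriction, so induction and restriction are exact and preserve
    finitely generated projectives; hence both preserve finite n-presentations
    and projective resolutions. Every RH-module M is a retract of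
    Res (RG (x)_RH M), and if [\sum_i a_i (x) b_i] is a separability element,
    then [m |-> \sum_i a_i (x) b_i m] makes every RG-module M a retract of
    RG (x)_RH (Res M). Finally, projective dimension does not grow when passing
    to a retract. *)

Set Implicit Arguments.
Unset Strict Implicit.
Unset Printing Implicit Defensive.

Import GRing.Theory.
Local Open Scope ring_scope.

(** * Kernels, lifts into kernels, and retracts *)

Section LinearMaps.
Variable A : pzRingType.

Definition linear_of (M N : lmodType A) (f : M -> N) (f_lin : linear f) :
    {linear M -> N} :=
  HB.pack f (GRing.isLinear.Build A M N *:%R f f_lin).

Definition linear_comp (L M N : lmodType A) (g : {linear M -> N})
  (f : {linear L -> M}) : {linear L -> N} := g \o f.

Definition retract_of (M N : lmodType A) : Prop :=
  exists (i : {linear M -> N}) (p : {linear N -> M}), cancel i p.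

Definition ker_pred (M N : lmodType A) (f : {linear M -> N}) : {pred M} :=
  fun x => f x == 0.

Fact ker_submod (M N : lmodType A) (f : {linear M -> N}) :
  submod_closed (ker_pred f).
Proof.
split=> [|a x y]; rewrite !unfold_in ?linear0 // => /eqP fx /eqP fy.
by rewrite linearP fx fy scaler0 addr0.
Qed.

HB.instance Definition _ (M N : lmodType A) (f : {linear M -> N}) :=
  GRing.isSubmodClosed.Build A M (ker_pred f) (ker_submod f).

Record ker (M N : lmodType A) (f : {linear M -> N}) :=
  Ker { ker_val :> M; _ : ker_val \in ker_pred f }.

HB.instance Definition _ (M N : lmodType A) (f : {linear M -> N}) :=
  [isSub for @ker_val M N f].
HB.instance Definition _ (M N : lmodType A) (f : {linear M -> N}) :=
  [Choice of ker f by <:].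
HB.instance Definition _ (M N : lmodType A) (f : {linear M -> N}) :=
  [SubChoice_isSubLmodule of ker f by <:].

Definition ker_incl (M N : lmodType A) (f : {linear M -> N}) :
  {linear ker f -> M} := val.

Lemma ker_inclP (M N : lmodType A) (f : {linear M -> N}) (x : ker f) :
  f (ker_incl f x) = 0.
Proof. by case: x => x /= /eqP. Qed.

Lemma ker_incl_inj (M N : lmodType A) (f : {linear M -> N}) :
  injective (ker_incl f).
Proof. exact: val_inj. Qed.

Lemma ker_incl_ex (M N : lmodType A) (f : {linear M -> N}) (x : M) :
  f x = 0 -> exists k, ker_incl f k = x.
Proof. by move=> /eqP fx; exists (Ker (fx : x \in ker_pred f)). Qed.

Lemma ker_lift (L M N : lmodType A) (f : {linear M -> N})
    (g : {linear L -> M}) : (forall x, f (g x) = 0) ->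
  exists h : {linear L -> ker f}, forall x, ker_incl f (h x) = g x.
Proof.
move=> fg0; have kg x : g x \in ker_pred f by rewrite unfold_in fg0.
pose h x : ker f := Ker (kg x).
have h_lin : linear h by move=> a x y; apply: val_inj; rewrite /= linearP.
by exists (linear_of h_lin).
Qed.

End LinearMaps.

(** * Projective dimension through iterated kernels *)

Section ProjectiveDimension.
Variable A : pzRingType.
Implicit Types M N K P Q : lmodType A.

Lemma projective_retract M N : retract_of M N -> projective N -> projective M.
Proof.
move=> [i [p ip]] projN U V q f q_surj.
have [h hE] := projN U V q (linear_comp f p) q_surj.
by exists (linear_comp h i) => x; rewrite /= hE /= ip.
Qed.

Lemma projective_sum M N :
  projective M -> projective N -> projective (M * N)%type.
Proof.
move=> projM projN U V q f q_surj.
have inl_lin : linear (fun x : M => (x, 0) : M * N).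
  by move=> a x y; apply: injective_projections; rewrite /= ?scaler0 ?addr0.
have inr_lin : linear (fun y : N => (0, y) : M * N).
  by move=> a x y; apply: injective_projections; rewrite /= ?scaler0 ?addr0.
have [h hE] := projM U V q (linear_comp f (linear_of inl_lin)) q_surj.
have [k kE] := projN U V q (linear_comp f (linear_of inr_lin)) q_surj.
have hk_lin : linear (fun x : M * N => h x.1 + k x.2).
  by move=> a x y; rewrite !linearP scalerDr addrACA.
exists (linear_of hk_lin) => -[x y] /=; rewrite linearD hE kE /= -linearD.
by congr (f _); apply: injective_projections; rewrite /= ?addr0 ?add0r.
Qed.

(** Some surjection from a projective is asked for, not every one. In this recursive form, stability
    under retracts becomes an induction on [m]. *)
Fixpoint pd_le (m : nat) M : Prop :=
  if m is m'.+1 then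
    exists2 P, projective P &
      exists2 p : {linear P -> M}, surjective_map p & pd_le m' (ker p)
  else projective M.

(* Let i : M -> N and p : N -> M with p i = 1, q : P -> N onto with P
   projective, and f = p q. A lift a : P -> P of i f along q satisfies f a = f,
   so x = a x + (x - a x) exhibits ker f as a retract of ker q * P; this replaces
   Schanuel's lemma. *)
Lemma pd_le_retract_sum m :
  (forall M N, retract_of M N -> pd_le m N -> pd_le m M) /\
  (forall K P, pd_le m K -> projective P -> pd_le m (K * P)%type).
Proof.
elim: m => [|m [IHr IHs]]; split => /=.
- exact: projective_retract.
- exact: projective_sum.
- move=> M N [i [p ip]] [P projP [q q_surj pdK]].
  exists P => //; exists (linear_comp p q).
    by move=> y; have [x qx] := q_surj (i y); exists x; rewrite /= qx ip.
  set f := linear_comp p q.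
  have [a aE] := projP P N q (linear_comp i f) q_surj.
  apply: IHr (IHs _ _ pdK projP).
  have [u uE] : exists u : {linear ker f -> ker q},
      forall x, ker_incl q (u x) = a (ker_incl f x).
    apply: (ker_lift (g := linear_comp a (ker_incl f))) => x.
    by rewrite /= aE /= -[p _]/(f _) ker_inclP linear0.
  have [v vE] : exists v : {linear ker q -> ker f},
      forall x, ker_incl f (v x) = ker_incl q x.
    by apply: ker_lift => x; rewrite /= ker_inclP linear0.
  have w_lin : linear (fun y => y - a y).
    by move=> c x y; rewrite linearP opprD addrACA scalerBr.
  have [w wE] : exists w : {linear P -> ker f},
      forall x, ker_incl f (w x) = x - a x.
    apply: (ker_lift (g := linear_of w_lin)) => x.
    by rewrite /= !linearB /= aE /= ip subrr.
  have i_lin : linear (fun x => (u x, ker_incl f x)).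
    by move=> c x y; rewrite !linearP.
  have p_lin : linear (fun z : ker q * P => v z.1 + w z.2).
    by move=> c x y; rewrite !linearP scalerDr addrACA.
  exists (linear_of i_lin), (linear_of p_lin) => x /=.
  by apply: ker_incl_inj; rewrite linearD vE uE wE addrC subrK.
- move=> K P [Q projQ [q q_surj pdK]] projP.
  exists (Q * P)%type; first exact: projective_sum.
  have p_lin : linear (fun z : Q * P => (q z.1, z.2) : K * P).
    by move=> c x y; rewrite linearP.
  exists (linear_of p_lin).
    by move=> [x y]; have [z <-] := q_surj x; exists (z, y).
  (* The kernel of [q] times the identity lies in the first factor, so it is a retract of
     [ker q]. *)
  set p := linear_of p_lin; apply: IHr pdK.
  have fst_lin : linear (fun x : ker p => (ker_incl p x).1).
    by move=> c x y; rewrite linearP.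
  have [u uE] : exists u : {linear ker p -> ker q},
      forall x, ker_incl q (u x) = (ker_incl p x).1.
    apply: (ker_lift (g := linear_of fst_lin)) => x.
    by have /(congr1 fst) := ker_inclP x.
  have inl_lin : linear (fun x => (ker_incl q x, 0) : Q * P).
    by move=> c x y; apply: injective_projections; rewrite /= ?linearP ?scaler0 ?addr0.
  have [v vE] : exists v : {linear ker q -> ker p},
      forall x, ker_incl p (v x) = (ker_incl q x, 0).
    apply: (ker_lift (g := linear_of inl_lin)) => x.
    by congr pair; rewrite ker_inclP.
  exists u, v => x; apply: ker_incl_inj; rewrite vE uE.
  by move: (congr1 snd (ker_inclP x)); case: (ker_incl p x) => y z /= ->.
Qed.


Lemma pd_le_retract m M N : retract_of M N -> pd_le m N -> pd_le m M.
Proof. exact: (pd_le_retract_sum m).1. Qed.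

Lemma linear_inverse M N (f : {linear M -> N}) :
    surjective_map f -> (forall x, f x = 0 -> x = 0) ->
  exists g : {linear N -> M}, cancel f g /\ cancel g f.
Proof.
move=> f_surj f0; have f_inj : injective f.
  by move=> x y /eqP; rewrite -subr_eq0 -linearB => /eqP /f0 /subr0_eq.
have f_ex y : exists x, f x == y by have [x <-] := f_surj y; exists x.
pose g y := xchoose (f_ex y).
have fg : cancel g f by move=> y; apply/eqP; exact: (xchooseP (f_ex y)).
have g_lin : linear g.
  by move=> a x y; apply: f_inj; rewrite linearP !fg.
by exists (linear_of g_lin); split=> // x; apply: f_inj; rewrite /= fg.
Qed.

(** Dropping the first term of a resolution resolves the kernel of its augmentation; conversely, a
    resolution of [ker p] is spliced onto [P] through [ker_incl p]. *)
Lemma proj_dim_leP m M : proj_dim_le m M <-> pd_le m M.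
Proof.
split.
  elim: m M => [|m IHm] M [P [d [e [[e_surj ed] dd projP P0]]]] /=.
    (* At length 0 the term [P 1] vanishes, so [e] is an isomorphism. *)
    have [|g [_ ge]] := linear_inverse e_surj.
      by move=> x /ed [y <-]; rewrite (P0 1%N _ y) ?linear0.
    by apply: projective_retract (projP 0%N); exists g, e.
  exists (P 0%N) => //; exists e => //; apply: IHm.
  have [e' e'E] : exists h : {linear P 1%N -> ker e},
      forall x, ker_incl e (h x) = d 0%N x.
    by apply: ker_lift => x; apply/ed; exists x.
  exists (fun i => P i.+1), (fun i => d i.+1), e'.
  split=> [|i|i|i mi]; [split | exact: dd | exact: projP | exact: P0].
    move=> y; have [x xE] := (ed _).1 (ker_inclP y).
    by exists x; apply: ker_incl_inj; rewrite e'E.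
  move=> y; split=> [|[x <-]].
    by move/(congr1 (ker_incl e)); rewrite e'E linear0 => /dd.
  by apply: ker_incl_inj; rewrite e'E linear0; apply/dd; exists x.
elim: m M => [|m IHm] M /=.
  (* Row vectors of length 0 serve as the zero module in all positive degrees. *)
  move=> projM; pose Z : lmodType A := 'rV[A]_0.
  have Z0 (x y : Z) : x = y by rewrite (thinmx0 x) (thinmx0 y).
  have zero_lin (K : lmodType A) : linear (fun _ : Z => 0 : K).
    by move=> a x y; rewrite scaler0 addr0.
  pose P i := if i is _.+1 then Z else M.
  exists P, (fun i => linear_of (zero_lin (P i))), (linear_of (f := id) (fun _ _ _ => erefl)).
  split.
  - split=> [y|y /=]; first by exists y.
    by split=> [->|[_ <-]//]; exists 0.
  - by move=> [|i] y; split=> // _; exists 0; apply: Z0.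
  - move=> [|i] //= U V q f _; exists (linear_of (zero_lin U)) => x /=.
    by rewrite linear0 (Z0 x 0) linear0.
  - by move=> [|i] // _ x; apply: Z0.
move=> [P projP [p p_surj /IHm [Q [d [e [[e_surj ed] dd projQ Q0]]]]]].
pose F i := if i is j.+1 then Q j else P.
pose dF i : {linear F i.+1 -> F i} :=
  if i is j.+1 then d j else linear_comp (ker_incl p) e.
exists F, dF, p; split=> [|[|i]|[|i]|[|i]] //=.
- split=> // y; split=> [py0|[x <-]]; last exact: ker_inclP.
  by have [k <-] := ker_incl_ex py0; have [x <-] := e_surj k; exists x.
- move=> y; split=> [|[x <-]].
    by move=> ye; apply/ed; apply: ker_incl_inj; rewrite [LHS]ye linear0.
  by rewrite /= (_ : e _ = 0) ?linear0 //; apply/ed; exists x.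
- exact: Q0.
Qed.

End ProjectiveDimension.

(** * Functors carrying presentations and resolutions termwise *)

Section ResolutionFunctors.

Record resolution_functor (A B : pzRingType) := ResolutionFunctor {
  rf_obj :> lmodType A -> lmodType B;
  rf_map : forall M N : lmodType A, {linear M -> N} ->
    {linear rf_obj M -> rf_obj N};
  rf_surj : forall (M N : lmodType A) (f : {linear M -> N}),
    surjective_map f -> surjective_map (rf_map f);
  rf_exact : forall (L M N : lmodType A) (f : {linear L -> M})
    (g : {linear M -> N}), exact_at f g -> exact_at (rf_map f) (rf_map g);
  rf_proj : forall P : lmodType A, projective P -> projective (rf_obj P);
  rf_fg : forall M : lmodType A, fin_generated M -> fin_generated (rf_obj M);
  rf_zero : forall M : lmodType A,
    (forall x : M, x = 0) -> forall x : rf_obj M, x = 0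
}.

Variables (A B : pzRingType) (F : resolution_functor A B).

Lemma rf_fin_presented n (M : lmodType A) :
  fin_presented n M -> fin_presented n (F M).
Proof.
move=> [P [d [e [e_surj ed dd PP]]]].
exists (fun i => F (P i)), (fun i => rf_map F (d i)), (rf_map F e).
split=> [|n0|i lin|i /PP [fgP projP]].
- exact: rf_surj.
- by apply: rf_exact; apply: ed.
- by apply: rf_exact; apply: dd.
- by split; [apply: rf_fg | apply: rf_proj].
Qed.

Lemma rf_proj_dim_le m (M : lmodType A) :
  proj_dim_le m M -> proj_dim_le m (F M).
Proof.
move=> [P [d [e [[e_surj ed] dd projP P0]]]].
exists (fun i => F (P i)), (fun i => rf_map F (d i)), (rf_map F e).
split=> [|i|i|i /P0].
- by split; [apply: rf_surj | apply: rf_exact].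
- exact: rf_exact.
- exact: rf_proj.
- exact: rf_zero.
Qed.

End ResolutionFunctors.

(** For a finitely n-presented [M], the bound on the [A]-module [E M] passes to [F (E M)], and from
    there to its retract [M]. *)
Lemma nd_ring_transfer (A B : pzRingType) (F : resolution_functor A B)
    (E : resolution_functor B A) (n d : nat) :
    (forall M : lmodType B, retract_of M (F (E M))) ->
  left_nd_ring n d A -> left_nd_ring n d B.
Proof.
move=> FE ndA M /(rf_fin_presented E) /ndA /(rf_proj_dim_le F) /proj_dim_leP pdM.
by apply/proj_dim_leP; apply: pd_le_retract pdM.
Qed.

Lemma fin_generated_fintype (A : pzRingType) (M : lmodType A) (I : finType)
    (e : I -> M) :
  (forall x, exists c : I -> A, x = \sum_i c i *: e i) -> fin_generated M.
Proof.
move=> eM; exists #|I|, (e \o enum_val) => x; have [c ->] := eM x.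
exists (c \o enum_val).
by rewrite (reindex (enum_val (A := I))) //; apply/onW_bij/enum_val_bij.
Qed.

(** A synonym of [M] that records [iota], keeping the [S]-structure apart from the [A]-structure. *)
Definition restr (S A : pzRingType) (iota : {rmorphism S -> A})
  (M : lmodType A) : Type := M.

(** * Restriction of scalars *)

Section RestrictionOfScalars.
Variables (S A : pzRingType) (iota : {rmorphism S -> A}).

Variable M : lmodType A.
Local Notation restr := (restr iota).

HB.instance Definition _ := GRing.Zmodule.copy (restr M) M.

Definition restr_scale (s : S) (x : restr M) : restr M := iota s *: (x : M).

Fact restr_scaleA s t x :
  restr_scale s (restr_scale t x) = restr_scale (s * t) x.
Proof. by rewrite /restr_scale scalerA rmorphM. Qed.

Fact restr_scale1 : left_id 1 restr_scale.
Proof. by move=> x; rewrite /restr_scale rmorph1 scale1r. Qed.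

Fact restr_scaleDr : right_distributive restr_scale +%R.
Proof. by move=> s x y; rewrite /restr_scale scalerDr. Qed.

Fact restr_scaleDl x : {morph restr_scale^~ x : s t / s + t}.
Proof. by move=> s t; rewrite /restr_scale rmorphD scalerDl. Qed.

HB.instance Definition _ := GRing.Zmodule_isLmodule.Build S (restr M)
  restr_scaleA restr_scale1 restr_scaleDr restr_scaleDl.

Lemma restrZ (s : S) (x : M) : s *: (x : restr M) = iota s *: x.
Proof. by []. Qed.

End RestrictionOfScalars.

Section RestrictionMap.
Variables (S A : pzRingType) (iota : {rmorphism S -> A}).
Variables (M N : lmodType A) (f : {linear M -> N}).

Definition restr_fun : restr iota M -> restr iota N := f.

Fact restr_fun_linear : linear restr_fun.
Proof. by move=> s x y; rewrite /restr_fun restrZ linearP. Qed.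

Definition restr_map := linear_of restr_fun_linear.

End RestrictionMap.

(** * Modules over a skew group ring *)

Section SkewModules.
Variables (G : finGroupType) (R : pzRingType) (alpha : ring_action G R).
Local Notation mono := (skew_mono alpha).

Lemma skew_mono0 g : mono 0 g = 0.
Proof. by apply/ffunP => k; rewrite !ffunE if_same. Qed.

Lemma skew_monoD a b g : mono (a + b) g = mono a g + mono b g.
Proof. by apply/ffunP => k; rewrite !ffunE; case: ifP; rewrite ?addr0. Qed.

Lemma skew_mono_sum (I : Type) (r : seq I) (F : I -> R) g :
  mono (\sum_(i <- r) F i) g = \sum_(i <- r) mono (F i) g.
Proof. exact: (big_morph _ (fun a b => skew_monoD a b g) (skew_mono0 g)). Qed.

Lemma skew_mono_split (a : R) g : mono a g = mono a 1%g * mono 1 g.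
Proof. by rewrite skew_monoM rmorph1 mulr1 mul1g. Qed.

(** Monomials span the skew ring additively, so additivity reduces linearity to them. *)
Lemma skew_linear (M N : lmodType (skew_ring alpha)) (f : M -> N) :
    zmod_morphism f -> (forall a g x, f (mono a g *: x) = mono a g *: f x) ->
  linear f.
Proof.
move=> fB fZ; pose F : {additive M -> N} :=
  HB.pack f (GRing.isZmodMorphism.Build M N f fB).
have FZ (c : skew_ring alpha) x : F (c *: x) = c *: F x.
  rewrite [c]skew_sum_mono !scaler_suml raddf_sum.
  by apply: eq_bigr => g _; apply: fZ.
by move=> c x y; rewrite -[f]/(F : M -> N) raddfD FZ.
Qed.

End SkewModules.

(** * Induction from RH to RG, realised as coinduction *)

Section Coinduction.
Variables (G : finGroupType) (R : pzRingType) (alpha : ring_action G R).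
Variable H : {group G}.
Local Notation RG := (skew_ring alpha).
Local Notation RH := (skew_ring (restrict_action alpha H)).
Local Notation mono := (skew_mono alpha).
Local Notation monoH := (skew_mono (restrict_action alpha H)).
Local Notation res := (restr (@skew_incl G R alpha H)).

Lemma res_monoZ (M : lmodType RG) a h (x : M) :
  monoH a h *: (x : res M) = mono a (sgval h) *: x.
Proof. by rewrite restrZ -skew_incl_mono. Qed.

Section CoindModule.
Variable M : lmodType RH.

(** This is Hom over RH from RG to [M]: an R-linear map on RG is given by its values on the basis
    [G], and RH-linearity then amounts to compatibility with each [h]. Finiteness of [G] and [H]
    makes the condition boolean. *)
Definition coind_pred : {pred {ffun G -> M}} := fun f =>
  [forall h : subg_of H, forall x, f (sgval h * x)%g == monoH 1 h *: f x].

Fact coind_zmod : zmod_closed coind_pred.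
Proof.
split=> [|f f'].
  by apply/forallP => h; apply/forallP => x; rewrite !ffunE scaler0.
move=> /forallP fH /forallP f'H; apply/forallP => h; apply/forallP => x.
rewrite !ffunE (eqP (forallP (fH h) x)) (eqP (forallP (f'H h) x)).
by rewrite scalerBr.
Qed.

HB.instance Definition _ :=
  GRing.isZmodClosed.Build {ffun G -> M} coind_pred coind_zmod.

Record coind :=
  Coind { coind_val :> {ffun G -> M}; _ : coind_val \in coind_pred }.

HB.instance Definition _ := [isSub for coind_val].
HB.instance Definition _ := [Choice of coind by <:].
HB.instance Definition _ := [SubChoice_isSubZmodule of coind by <:].

Lemma coindP (f : coind) h x : f (sgval h * x)%g = monoH 1 h *: f x.
Proof. by case: f => f /= /forallP fH; apply/eqP/(forallP (fH h)). Qed.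

Lemma coind_eq (f f' : coind) : f =1 f' -> f = f'.
Proof. by move=> ff'; apply: val_inj; apply/ffunP. Qed.

Lemma coindB (f f' : coind) x : (f - f') x = f x - f' x.
Proof. by rewrite -[_ x]/(val (f - f') x) raddfB !ffunE. Qed.

Lemma coindD (f f' : coind) x : (f + f') x = f x + f' x.
Proof. by rewrite -[_ x]/(val (f + f') x) raddfD !ffunE. Qed.

Lemma coind0 x : (0 : coind) x = 0.
Proof. by rewrite -[_ x]/(val (0 : coind) x) raddf0 ffunE. Qed.

Lemma coind_sum (I : Type) (r : seq I) (P : pred I) (F : I -> coind) x :
  (\sum_(i <- r | P i) F i) x = \sum_(i <- r | P i) F i x.
Proof.
by elim/big_rec2: _ => [|i y f _ <-]; rewrite ?coind0 ?coindD.
Qed.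

Definition coind_mk (f : G -> M)
    (fH : forall h x, f (sgval h * x)%g = monoH 1 h *: f x) : coind.
Proof.
exists (finfun f); apply/forallP => h; apply/forallP => x.
by rewrite !ffunE fH.
Defined.

Lemma coind_mkE f fH x : @coind_mk f fH x = f x.
Proof. exact: ffunE. Qed.

(* (a g) f = [x |-> x(a) f (x g)], where x(a) in R acts on M through RH. *)
Definition coind_act (c : RG) (f : coind) (x : G) : M :=
  \sum_g monoH (alpha x (c g)) 1%g *: f (x * g)%g.

(** In RH, [h] times [x(a)] equals [(h x)(a)] times [h]. *)
Fact coind_actP c f h x :
  coind_act c f (sgval h * x)%g = monoH 1 h *: coind_act c f x.
Proof.
rewrite scaler_sumr; apply: eq_bigr => g _.
rewrite -mulgA coindP !scalerA !skew_monoM.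
by rewrite mul1g mulg1 mul1r rmorph1 mulr1 ra_actM.
Qed.

Definition coind_scale c f := coind_mk (coind_actP c f).

Lemma coind_scaleE c f x :
  coind_scale c f x = \sum_g monoH (alpha x (c g)) 1%g *: f (x * g)%g.
Proof. exact: coind_mkE. Qed.

Fact coind_scaleA c c' f :
  coind_scale c (coind_scale c' f) = coind_scale (c * c') f.
Proof.
apply: coind_eq => x; rewrite !coind_scaleE.
under eq_bigr => g _ do rewrite coind_scaleE scaler_sumr.
under [RHS]eq_bigr => m _ do
  rewrite ffunE rmorph_sum skew_mono_sum scaler_suml.
rewrite [RHS]exchange_big; apply: eq_bigr => g _ /=.
rewrite [RHS](reindex_inj (mulgI g)) /=; apply: eq_bigr => k _.
by rewrite scalerA skew_monoM mulg1 /= ra_act1 mulKg mulgA rmorphM ra_actM.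
Qed.

Fact coind_scale1 : left_id 1 coind_scale.
Proof.
move=> f; apply: coind_eq => x; rewrite coind_scaleE (bigD1 1%g) //= big1.
  by rewrite ffunE eqxx rmorph1 scale1r mulg1 addr0.
move=> g /negPf g1; rewrite ffunE g1 rmorph0.
by rewrite skew_mono0 scale0r.
Qed.

Fact coind_scaleDr : right_distributive coind_scale +%R.
Proof.
move=> c f f'; apply: coind_eq => x; rewrite coindD !coind_scaleE -big_split.
by apply: eq_bigr => g _; rewrite coindD scalerDr.
Qed.

Fact coind_scaleDl f : {morph coind_scale^~ f : c c' / c + c'}.
Proof.
move=> c c'; apply: coind_eq => x; rewrite coindD !coind_scaleE -big_split.
apply: eq_bigr => g _.
by rewrite ffunE rmorphD skew_monoD scalerDl.
Qed.

HB.instance Definition _ := GRing.Zmodule_isLmodule.Build RG coind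
  coind_scaleA coind_scale1 coind_scaleDr coind_scaleDl.

Lemma coindZ_mono a g (f : coind) x :
  (mono a g *: f) x = monoH (alpha x a) 1%g *: f (x * g)%g.
Proof.
rewrite [LHS]coind_scaleE (bigD1 g) //= big1 => [|k /negPf kg].
  by rewrite ffunE eqxx addr0.
by rewrite ffunE kg rmorph0 skew_mono0 scale0r.
Qed.

End CoindModule.
Section CoindMap.
Variables (M N : lmodType RH) (p : {linear M -> N}).

Fact coind_map_subproof (f : coind M) h x :
  p (f (sgval h * x)%g) = monoH 1 h *: p (f x).
Proof. by rewrite coindP linearZ. Qed.

Definition coind_fun f := coind_mk (coind_map_subproof f).

Lemma coind_funE f x : coind_fun f x = p (f x).
Proof. exact: coind_mkE. Qed.

Fact coind_fun_linear : linear coind_fun.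
Proof.
apply: skew_linear => [f f' | a g f]; apply: coind_eq => x.
  by rewrite coindB !coind_funE coindB linearB.
by rewrite coindZ_mono !coind_funE coindZ_mono linearZ.
Qed.

Definition coind_map := linear_of coind_fun_linear.

Lemma coind_mapE (f : coind M) x : coind_map f x = p (f x).
Proof. exact: coind_mkE. Qed.

End CoindMap.

(** * The unit of induction and the evaluation at 1 *)

Section CoindUnit.
Variable M : lmodType RH.

Fact coind_unit_subproof (m : M) h x :
  (if (sgval h * x)%g \in H then monoH 1 (subg H (sgval h * x)%g) *: m else 0)
  = monoH 1 h *: (if x \in H then monoH 1 (subg H x) *: m else 0).
Proof.
rewrite groupMl ?subgP //; case: ifP => xH; last by rewrite scaler0.
rewrite scalerA skew_monoM rmorph1 mulr1; congr (skew_mono _ _ _ *: _).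
by apply: val_inj; rewrite /= !subgK // groupM ?subgP.
Qed.

(* m is sent to 1 (x) m, i.e. to the function [h |-> h m] supported on H. *)
Definition coind_unit_fun (m : M) : res (coind M) :=
  coind_mk (coind_unit_subproof m).

Lemma coind_unit_funE (m : M) x : (coind_unit_fun m : coind M) x =
  if x \in H then monoH 1 (subg H x) *: m else 0.
Proof. exact: coind_mkE. Qed.

Fact coind_unit_linear : linear coind_unit_fun.
Proof.
apply: skew_linear => [m m' | a h m]; apply: coind_eq => x.
  rewrite [RHS](coindB (coind_unit_fun m) (coind_unit_fun m')).
  rewrite !coind_unit_funE; case: ifP => _; last by rewrite subr0.
  by rewrite scalerBr.
rewrite res_monoZ coindZ_mono !coind_unit_funE groupMr ?subgP //.
case: ifP => xH; last by rewrite scaler0.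
rewrite !scalerA !skew_monoM mul1r mul1g rmorph1 mulr1 /= subgK //.
congr (skew_mono _ _ _ *: _).
by apply: val_inj; rewrite /= !subgK // groupM ?subgP.
Qed.

Definition coind_unit := linear_of coind_unit_linear.

Lemma coind_unitE (m : M) x : (coind_unit m : coind M) x =
  if x \in H then monoH 1 (subg H x) *: m else 0.
Proof. exact: coind_unit_funE. Qed.

Lemma coind_unit1 (m : M) : (coind_unit m : coind M) 1%g = m.
Proof.
rewrite coind_unitE group1 (_ : subg H 1%g = 1%g) ?scale1r //.
by apply: val_inj; rewrite /= subgK.
Qed.

(** The counit of coinduction as right adjoint of restriction. It is RH-linear because left and
    right translation by [h] agree at 1. *)
Definition coind_eval_fun (f : res (coind M)) : M := (f : coind M) 1%g.

Fact coind_eval_linear : linear coind_eval_fun.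
Proof.
apply: skew_linear => [f f' | a h f]; rewrite /coind_eval_fun ?coindB //.
rewrite res_monoZ coindZ_mono ra_act1 mul1g.
by rewrite -[sgval h]mulg1 coindP scalerA -skew_mono_split.
Qed.

Definition coind_eval := linear_of coind_eval_linear.

End CoindUnit.

(** Right translation by [g] permutes the right cosets, and [repr X * g] lies in the same coset as
    the representative of [X g], where [F] is constant. *)
Lemma rcosets_sum_shift (V : nmodType) (F : G -> V) g :
    (forall (h : subg_of H) x, F (sgval h * x)%g = F x) ->
  \sum_(X in rcosets H [set: G]) F (repr X * g)%g =
  \sum_(X in rcosets H [set: G]) F (repr X).
Proof.
move=> FH; have Fcoset x y : y \in (H :* x)%g -> F y = F x.
  by case/rcosetP => h hH ->; rewrite -(subgK h hH) FH.
rewrite [RHS](reindex_inj (h := fun X : {set G} => X :* g)%g) /=; last first.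
  by move=> X Y /(congr1 (rcoset^~ g^-1)%g) /=; rewrite !rcosetE !rcosetK.
apply: eq_big => [X|X /rcosetsP [x _ ->]].
  apply/idP/idP => /rcosetsP [x _ XE]; apply/rcosetsP.
    by exists (x * g)%g; rewrite ?inE // XE rcosetM.
  by exists (x * g^-1)%g; rewrite ?inE // rcosetM -XE rcosetK.
apply: Fcoset; apply/rcoset_eqP.
by rewrite -rcosetM rcoset_repr !rcosetM rcoset_repr.
Qed.

(* The map RG (x)_RH M -> N induced by u : M -> Res N; under the identification
   with functions, f is \sum_X x^-1 (x) f x with x in X representing the cosets. *)
Section CoindExt.
Variables (M : lmodType RH) (N : lmodType RG) (u : {linear M -> res N}).

Definition coind_ext_fun (f : coind M) : N :=
  \sum_(X in rcosets H [set: G]) mono 1 (repr X)^-1%g *: (u (f (repr X)) : N).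

Lemma coind_ext_linear : linear coind_ext_fun.
Proof.
apply: skew_linear => [f f' | a g f].
  rewrite /coind_ext_fun -sumrB; apply: eq_bigr => X _.
  by rewrite coindB linearB scalerBr.
rewrite /coind_ext_fun.
(* The summand depends only on the coset of [x], so the right-hand sum may be taken at the points
   [repr X * g], where the left-hand side evaluates [f]. *)
rewrite -(@rcosets_sum_shift _ (fun x => mono 1 x^-1%g *: (u (f x) : N)) g).
  rewrite scaler_sumr; apply: eq_bigr => X _.
  rewrite coindZ_mono linearZZ res_monoZ !scalerA !skew_monoM.
  by rewrite !rmorph1 mul1r mulr1 mulg1 invMg mulKVg -ra_actM mulVg ra_act1.
move=> h x; rewrite coindP linearZZ res_monoZ scalerA skew_monoM.
by rewrite rmorph1 mulr1 invMg mulgKV.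
Qed.

Definition coind_ext := linear_of coind_ext_linear.

Lemma coind_ext_comp_unit (m : M) : coind_ext (coind_unit M m) = u m.
Proof.
(* The unit is supported on [H], whose chosen representative is 1. *)
rewrite /= /coind_ext_fun (bigD1 (H : {set G})) /=.
  rewrite repr_group coind_unit1 invg1 scale1r big1 ?addr0 //.
  move=> _ /andP [/rcosetsP [x _ ->] xH].
  rewrite coind_unitE ifN ?linear0 ?scaler0 //; apply: contra xH => xH.
  by rewrite -(rcoset_repr H x) (rcoset_id xH).
by apply/rcosetsP; exists 1%g; rewrite ?mulg1.
Qed.

End CoindExt.

(** At [y] only the coset [H y] contributes, and equivariance recovers [f y] from the value at its
    representative. So the image of the unit generates [coind M] over RG. *)
Lemma coind_ext_unit (M : lmodType RH) (f : coind M) :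
  coind_ext (coind_unit M) f = f.
Proof.
apply: coind_eq => y; rewrite [coind_ext _ _]/(coind_ext_fun _ _) coind_sum.
rewrite (bigD1 (H :* y)%g) /=; last by apply/rcosetsP; exists y.
rewrite big1 => [|X /andP [/rcosetsP [x _ ->] /negPf yx]]; last first.
  rewrite coindZ_mono rmorph1 scale1r coind_unitE ifN //.
  rewrite -mem_rcoset rcoset_repr; apply: contraFN yx => /rcoset_eqP ->.
  exact: eqxx.
rewrite addr0 coindZ_mono rmorph1 scale1r coind_unitE.
have /rcosetP [h hH hE] := mem_repr_rcoset H y.
have yh : (y * (repr (H :* y))^-1 = h^-1)%g by rewrite hE invMg mulKVg.
by rewrite yh groupV hH -coindP subgK ?groupV // {1}hE mulKg.
Qed.

(** Pointwise preimages need not be equivariant, so only those at coset representatives are kept and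
    spread over each coset by the unit. Surjectivity and exactness of coinduction both follow. *)
Lemma coind_map_image (L M : lmodType RH) (l : {linear L -> M})
    (f : coind M) : (forall x, exists y, l y = f x) ->
  exists f', coind_map l f' = f.
Proof.
move=> /fin_all_exists [y yE].
exists (\sum_(X in rcosets H [set: G])
          mono 1 (repr X)^-1%g *: (coind_unit L (y (repr X)) : coind L)).
rewrite -[RHS]coind_ext_unit linear_sum; apply: eq_bigr => X _.
rewrite linearZZ; congr (_ *: _); apply: coind_eq => x.
rewrite coind_mapE !coind_unitE -yE.
by case: ifP; rewrite ?linear0 ?linearZ.
Qed.

(** Induction is left adjoint to the exact restriction: lift the restriction of [f] to [P] along
    [p], extend by [coind_ext], and compare on the generators. *)
Lemma coind_projective (P : lmodType RH) :
  projective P -> projective (coind P).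
Proof.
move=> projP M N p f p_surj; pose resf := restr_map (@skew_incl G R alpha H) f.
have [v vE] := projP (res M) (res N) (restr_map (@skew_incl G R alpha H) p)
  (linear_comp resf (coind_unit P)) p_surj.
exists (coind_ext v) => c.
rewrite -[in RHS](coind_ext_unit c) !linear_sum; apply: eq_bigr => X _.
by rewrite !linearZZ; congr (_ *: _); apply: vE.
Qed.

Lemma coind_fin_generated (M : lmodType RH) :
  fin_generated M -> fin_generated (coind M).
Proof.
move=> [k [e eM]]; exists k, (fun i => coind_unit M (e i) : coind M) => f.
have /fin_all_exists [c cE] x := eM (f x).
(* Expand each [f x] in the generators [e i] and move the RH-coefficients across the tensor sign,
   next to [x^-1]. *)
exists (fun i => \sum_(X in rcosets H [set: G])
  mono 1 (repr X)^-1%g * skew_incl (c (repr X) i)).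
under [RHS]eq_bigr => i _ do rewrite scaler_suml.
rewrite exchange_big -[LHS]coind_ext_unit; apply: eq_bigr => X _.
rewrite cE linear_sum scaler_sumr; apply: eq_bigr => i _.
by rewrite linearZZ restrZ scalerA.
Qed.

(** Restriction is left adjoint to coinduction, which preserves surjections: transpose [f] to
    [x |-> (g |-> f (g x))], lift it along [coind_map p], and evaluate the lift at 1. *)
Lemma restr_projective (P : lmodType RG) : projective P -> projective (res P).
Proof.
move=> projP M N p f p_surj.
have fH (x : P) (h : subg_of H) g :
    f (mono 1 (sgval h * g)%g *: x) = monoH 1 h *: f (mono 1 g *: x).
  by rewrite -linearZZ res_monoZ scalerA skew_monoM rmorph1 mulr1.
pose F (x : P) : coind N := coind_mk (fH x).
have FE x g : F x g = f (mono 1 g *: x) by apply: coind_mkE.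
have F_lin : linear F.
  apply: skew_linear => [x x' | a g x]; apply: coind_eq => y.
    by rewrite coindB !FE scalerBr linearB.
  rewrite coindZ_mono !FE -linearZZ res_monoZ !scalerA !skew_monoM.
  by rewrite mul1r mul1g rmorph1 mulr1.
have map_surj : surjective_map (coind_map p).
  by move=> c; apply: coind_map_image => x; apply: p_surj.
have [h hE] := projP _ _ (coind_map p) (linear_of F_lin) map_surj.
exists (linear_comp (coind_eval M) (restr_map (@skew_incl G R alpha H) h)) => x.
have := congr1 (fun c : coind N => c 1%g) (hE x).
by rewrite coind_mapE => -> /=; rewrite FE scale1r.
Qed.

(** The finitely many elements [g e_i] generate, already with coefficients from R inside RH. *)
Lemma restr_fin_generated (M : lmodType RG) :
  fin_generated M -> fin_generated (res M).
Proof.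
move=> [k [e eM]].
apply: (fin_generated_fintype
  (e := fun z : 'I_k * G => mono 1 z.2 *: e z.1 : res M)) => x.
have [c ->] := eM x; exists (fun z => monoH (c z.1 z.2) 1%g).
rewrite -(pair_bigA _ (fun i g =>
  monoH (c i g) 1%g *: (mono 1 g *: e i : res M))) /=.
apply: eq_bigr => i _; rewrite {1}[c i]skew_sum_mono scaler_suml.
by apply: eq_bigr => g _; rewrite res_monoZ scalerA -skew_mono_split.
Qed.

(** * The two resolution functors and their retracts *)

Definition restr_functor : resolution_functor RG RH.
Proof.
apply: (@ResolutionFunctor RG RH (fun M => res M)
  (fun M N f => restr_map (@skew_incl G R alpha H) f)) => //.
- exact: restr_projective.
- exact: restr_fin_generated.
Defined.

Definition coind_functor : resolution_functor RH RG.
Proof.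
apply: (@ResolutionFunctor RH RG (fun M => coind M)
  (fun M N f => coind_map f)).
- by move=> M N p p_surj c; apply: coind_map_image => x; apply: p_surj.
- move=> L M N f g fg c; split=> [c0 | [c' <-]].
    apply: coind_map_image => x; apply/fg.
    by rewrite -coind_mapE c0 coind0.
  by apply: coind_eq => x; rewrite !coind_mapE coind0; apply/fg; exists (c' x).
- exact: coind_projective.
- exact: coind_fin_generated.
- by move=> M M0 c; apply: coind_eq => x; rewrite coind0; apply: M0.
Defined.

Lemma retract_restr_coind (M : lmodType RH) : retract_of M (res (coind M)).
Proof. by exists (coind_unit M), (coind_eval M) => m; apply: coind_unit1. Qed.

Lemma retract_coind_restr (M : lmodType RG) :
  separable_extension (@skew_incl G R alpha H) -> retract_of M (coind (res M)).
Proof.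
move=> [s [sA s1]].
pose eta (m : M) : coind (res M) := coind_unit (res M) m.
pose F (m : M) : coind (res M) := \sum_(z <- s) z.1 *: eta (z.2 *: m).
have F_lin : linear F.
  move=> a m m'.
  have -> : a *: F m = \sum_(z <- s) z.1 *: eta ((z.2 * a) *: m).
    (* The map sending [b (x) c] to [b (x) c m] is balanced, so it carries the identity for the
       separability element into the module; this is what makes [F] commute with [a]. *)
    have := tensor_eq_sum (f := fun b c => b *: eta (c *: m)) _ _ _ (sA a).
    rewrite !big_map => -> /=.
    - by rewrite scaler_sumr; apply: eq_bigr => z _; rewrite scalerA.
    - by move=> b b' c; rewrite scalerDl.
    - by move=> b c c'; rewrite /eta scalerDl linearD scalerDr.
    - by move=> b r c; rewrite -!scalerA /eta -!restrZ linearZZ.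
  rewrite -big_split; apply: eq_bigr => z _ /=.
  by rewrite /eta -scalerDr -linearD scalerDr scalerA.
(* Extending the identity gives the action map [a (x) m |-> a m]; its composite with [F] multiplies
   by the sum of the [a_i b_i], which is 1. *)
have id_lin : linear (id : res M -> res M) by [].
exists (linear_of F_lin), (coind_ext (linear_of id_lin)) => m.
rewrite -[linear_of _ m]/(F m) linear_sum -[RHS]scale1r -s1 scaler_suml.
apply: eq_bigr => z _; rewrite linearZZ -scalerA; congr (_ *: _).
by rewrite coind_ext_comp_unit.
Qed.

End Coinduction.

Theorem proposition3p2 (R : pzRingType) (G : finGroupType)
    (alpha : ring_action G R) (H : {group G}) (n d : nat) :
  (left_nd_ring n d (skew_ring alpha) ->
     left_nd_ring n d (skew_ring (restrict_action alpha H)))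
  /\
  (separable_extension (@skew_incl G R alpha H) ->
     (left_nd_ring n d (skew_ring alpha) <->
      left_nd_ring n d (skew_ring (restrict_action alpha H)))).
Proof.
have RG_RH := @nd_ring_transfer _ _ (restr_functor alpha H)
  (coind_functor alpha H) n d (@retract_restr_coind _ _ alpha H).
split=> // sepA; split=> //.
(* For the converse the functors exchange roles, and separability supplies the retract. *)
apply: (@nd_ring_transfer _ _ (coind_functor alpha H) (restr_functor alpha H)).
by move=> M; apply: retract_coind_restr.
Qed.
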